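(* The relaxation $(\mathrm{STD})$ of the discrete tomography problem is less tight than the relaxation $(\mathrm{CTG})$. That is: for every discrete tomography instance (as defined in the context), the optimal values satisfy $\mathrm{val}(\mathrm{STD}) \le \mathrm{val}(\mathrm{CTG})$, and there exists a discrete tomography instance for which $\mathrm{val}(\mathrm{STD}) < \mathrm{val}(\mathrm{CTG})$.
   Context: **Discrete tomography instance.** An instance consists of the following data. - An integer $k\ge 2$ and a finite graph $G=(V,E)$. The label spaces are $\mathcal{X}_u=\{0,1,\dots,k-1\}$ for $u\in V$, and $\mathcal{X}_U=\prod_{u\in U}\mathcal{X}_u$ for $U\subseteq V$. - Unary potentials $\theta_u:\mathcal{X}_u\to\mathbb{R}$, all identically zero ($\theta_u\equiv 0$ for all $u\in V$). - Pairwise potentials $\theta_{uv}:\mathcal{X}_u\times\mathcal{X}_v\to\mathbb{R}$ for $uv\in E$. - A matrix $A\in\{0,1\}^{m\times V}$ and a vector $b\in\mathbb{N}^m$ (with $0\in\mathbb{N}$). For each row $i$, the ray $U_i=\{u\in V: A_{iu}=1\}$ is nonempty and comes with a linear ordering $u^i_1,\dots,u^i_{n_i}$ of its nodes. Every edge of $G$ joins two consecutive nodes $u^i_j,u^i_{j+1}$ of exactly one ray $i$. Two consecutive nodes of a ray need not be joined by an edge, in which case their pairwise potential is taken to be zero. The discrete tomography problem is $$\min_{x\in\mathcal{X}_V}\ \sum_{u\in V}\theta_u(x_u)+\sum_{uv\in E}\theta_{uv}(x_u,x_v)\quad\text{s.t. } Ax=b.$$ **Relaxation (CTG).** For each $i=1,\dots,m$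 and $u\in U_i$ introduce a Lagrangian variable $\lambda_{i,u}\in\mathbb{R}^{\mathcal{X}_u}$, viewed as a function on $\mathcal{X}_u$. For $x\in\mathcal{X}_{U_i}$ set $$E_i(x\mid\lambda_i)=\sum_{u\in U_i}\lambda_{i,u}(x_u)+\sum_{j:\,1\le j<n_i,\ u^i_ju^i_{j+1}\in E}\theta_{u^i_ju^i_{j+1}}(x_{u^i_j},x_{u^i_{j+1}})$$ if $\sum_{u\in U_i}x_u=b_i$, and $E_i(x\mid\lambda_i)=+\infty$ otherwise. Then $$\mathrm{val}(\mathrm{CTG})=\sup_{\lambda_1,\dots,\lambda_m}\ \sum_{i=1}^m\ \min_{x\in\mathcal{X}_{U_i}}E_i(x\mid\lambda_i)\quad\text{s.t. }\sum_{i:\,u\in U_i}\lambda_{i,u}\equiv 0\ \ \forall u\in V,$$ a value in $\mathbb{R}\cup\{+\infty\}$. **Relaxation (STD).** $\mathrm{val}(\mathrm{STD})$ is the optimal value ($+\infty$ if infeasible) of the linear program over $\mu_u\in\mathbb{R}_{\ge 0}^{\mathcal{X}_u}$ ($u\in V$) and $\mu_{uv}\in\mathbb{R}_{\ge0}^{\mathcal{X}_u\times\mathcal{X}_v}$ ($uv\in E$): $$\min\ \sum_{u\in V}\langle\theta_u,\mu_u\rangle+\sum_{uv\in E}\langle\theta_{uv},\mu_{uv}\rangle$$ subject to - $\sum_{x_u\in\mathcal{X}_u}\mu_u(x_u)=1$ for all $u\in V$; - $\sum_{x_u\in\mathcal{X}_u}\mu_{uv}(x_u,x_v)=\mu_v(x_v)$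 for all $uv\in E$, $x_v\in\mathcal{X}_v$; - $\sum_{x_v\in\mathcal{X}_v}\mu_{uv}(x_u,x_v)=\mu_u(x_u)$ for all $uv\in E$, $x_u\in\mathcal{X}_u$; - $\sum_{u\in V}A_{iu}\bigl(\sum_{x_u\in\mathcal{X}_u}x_u\,\mu_u(x_u)\bigr)=b_i$ for $i=1,\dots,m$. *)

(* Defs.v *)
From HB Require Import structures.
From mathcomp Require Import all_boot all_order all_algebra.
From mathcomp Require Import classical_sets reals constructive_ereal ereal.

Set Implicit Arguments.
Unset Strict Implicit.
Unset Printing Implicit Defensive.

Import Order.TTheory GRing.Theory Num.Theory.

Local Open Scope ring_scope.

(* The undirected graph is given by the set [dt_edges] containing each edge
   exactly once, as an ordered pair [(u, v)]; the order chosen only fixes the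
   order of the arguments of theta_uv and mu_uv, and is unrelated to the
   ordering of the rays.  [infix [:: u; v] s] says that v immediately follows
   u in s. *)
Record dt_instance (R : realType) := DTInstance {
  dt_k : nat;
  dt_V : finType;
  dt_edges : {set dt_V * dt_V};
  dt_unary : dt_V -> 'I_dt_k -> R;
  dt_pair : dt_V -> dt_V -> 'I_dt_k -> 'I_dt_k -> R;
  dt_m : nat;
  dt_A : 'I_dt_m -> dt_V -> bool;
  dt_b : 'I_dt_m -> nat;
  dt_ray : 'I_dt_m -> seq dt_V;
  dt_k_ge2 : (2 <= dt_k)%N;
  dt_edges_once : forall u v, (u, v) \in dt_edges -> (v, u) \notin dt_edges;
  dt_unary0 : forall u a, dt_unary u a = 0;
  dt_ray_uniq : forall i, uniq (dt_ray i);
  dt_rayE : forall i u, (u \in dt_ray i) = dt_A i u;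
  dt_ray_nonempty : forall i, exists u, dt_A i u;
  dt_edge_ray : forall u v, (u, v) \in dt_edges ->
    exists! i, infix [:: u; v] (dt_ray i) || infix [:: v; u] (dt_ray i)
}.

Section Relaxations.
Variables (R : realType) (I : dt_instance R).

Local Notation k := (dt_k I).
Local Notation V := (dt_V I).
Local Notation m := (dt_m I).

Definition dt_U (i : 'I_m) : {set V} := [set u | dt_A i u].

Definition dt_adj (u v : V) : bool :=
  ((u, v) \in dt_edges I) || ((v, u) \in dt_edges I).

(* theta_uv with its arguments in the order u, v, whichever way the edge uv is
   stored; only meaningful when [dt_adj u v]. *)
Definition dt_theta (u v : V) (a c : 'I_k) : R :=
  if (u, v) \in dt_edges I then dt_pair u v a c else dt_pair v u c a.

(* lambda i u is only used for u in U_i. *)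
Definition CTG_multiplier : Type := 'I_m -> V -> 'I_k -> R.

Definition CTG_feasible (lambda : CTG_multiplier) : Prop :=
  forall (u : V) (a : 'I_k), \sum_(i < m | u \in dt_U i) lambda i u a = 0.

Definition CTG_energy (lambda : CTG_multiplier) (i : 'I_m)
    (x : {ffun {u : V | u \in dt_U i} -> 'I_k}) : \bar R :=
  if (\sum_u x u == dt_b i)%N then
    (\sum_u lambda i (val u) (x u) +
     \sum_u \sum_(v | infix [:: val u; val v] (dt_ray i) &&
                      dt_adj (val u) (val v))
       dt_theta (val u) (val v) (x u) (x v))%:E
  else +oo%E.

Definition CTG_objective (lambda : CTG_multiplier) : \bar R :=
  (\sum_(i < m)
     \big[Order.min/+oo]_(x : {ffun {u : V | u \in dt_U i} -> 'I_k})
       CTG_energy lambda x)%E.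

Definition val_CTG : \bar R :=
  ereal_sup [set CTG_objective lambda | lambda in CTG_feasible]%classic.

(* mu2 u v is only used for (u, v) in [dt_edges I]. *)
Record STD_feasible (mu1 : V -> 'I_k -> R)
    (mu2 : V -> V -> 'I_k -> 'I_k -> R) : Prop := STDFeasible {
  STD_mu1_ge0 : forall u a, 0 <= mu1 u a;
  STD_mu2_ge0 : forall u v a c, (u, v) \in dt_edges I -> 0 <= mu2 u v a c;
  STD_norm : forall u, \sum_a mu1 u a = 1;
  STD_marg_r : forall u v c, (u, v) \in dt_edges I ->
    \sum_a mu2 u v a c = mu1 v c;
  STD_marg_l : forall u v a, (u, v) \in dt_edges I ->
    \sum_c mu2 u v a c = mu1 u a;
  STD_ray : forall i : 'I_m,
    \sum_u (dt_A i u)%:R * (\sum_(a < k) (val a)%:R * mu1 u a) = (dt_b i)%:R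
}.

Definition STD_objective (mu1 : V -> 'I_k -> R)
    (mu2 : V -> V -> 'I_k -> 'I_k -> R) : R :=
  \sum_u \sum_a dt_unary u a * mu1 u a +
  \sum_(e in dt_edges I)
    \sum_a \sum_c dt_pair e.1 e.2 a c * mu2 e.1 e.2 a c.

Definition val_STD : \bar R :=
  ereal_inf [set (STD_objective mu.1 mu.2)%:E
            | mu in [set mu | STD_feasible mu.1 mu.2]]%classic.

End Relaxations.

(* Main.v *)
Require Import Defs.
From mathcomp Require Import all_boot all_order all_algebra.
From mathcomp Require Import classical_sets reals constructive_ereal ereal.
From mathcomp Require Import ring lra.

Set Implicit Arguments.
Unset Strict Implicit.
Unset Printing Implicit Defensive.
Import Order.TTheory GRing.Theory Num.Theory.
Local Open Scope ring_scope.

(* The sum over the rays of the minimal energies is a minimum of finitely many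
   affine functions of lambda, one for each choice of a labeling on every ray.
   If no feasible lambda makes all of them exceed c, a theorem of the
   alternative gives a convex combination of them that is constant and at most
   c.  It amounts to a probability distribution on the labelings of each ray
   meeting its sum constraint, with node marginals that agree across rays; its
   node and edge marginals are feasible for (STD), with objective at most c.

   The inequality is strict for a single ray with two nodes joined by an edge,
   two labels, b = 1, and pairwise cost 1 on unequal labels, 0 on equal ones:
   both labelings with sum 1 cost 1, but (STD) may put mass 1/2 on (0,0) and
   1/2 on (1,1). *)

(** * A theorem of the alternative for strict affine inequalities *)

Lemma strictly_between (R : realFieldType) (A B : seq R) :
    {in A & B, forall a b, a < b} ->
  exists t, {in A, forall a, a < t} /\ {in B, forall b, t < b}.
Proof.
move=> ltAB.
(* [lo] lies below all of [B] and serves as the maximum over an empty [A]; likewise [u + 1] below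
   serves when [B] is empty. *)
pose lo := \big[Num.min/0]_(b <- B) b - 1.
have lo_lt b : b \in B -> lo < b.
  by move=> bB; rewrite ltrBlDr ltr_pwDr // ge_bigmin_seq.
pose u := \big[Num.max/lo]_(a <- A) a.
have u_lt b : b \in B -> u < b.
  move=> bB; rewrite /u big_seq; apply: bigmax_lt; first exact: lo_lt.
  by move=> a aA; exact: ltAB.
pose w := \big[Num.min/u + 1]_(b <- B) b.
have ltuw : u < w.
  by rewrite /w big_seq; apply: lt_bigmin => //; rewrite ltrDl.
exists ((u + w) / 2); split=> [a aA | b bB].
  have : a <= u by exact: le_bigmax_seq.
  by move=> ?; lra.
have : w <= b by exact: ge_bigmin_seq.
by move=> ?; lra.
Qed.

Section Alternative.
Variables (R : realFieldType) (J : finType).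
Local Notation affine := ({ffun J -> R} * R)%type.
Implicit Types (s t : affine) (l : J -> R).

(* A pair (w, d) stands for the affine function l |-> <w, l> + d. *)
Definition affine_eval s l : R := \sum_j s.1 j * l j + s.2.

Lemma affine_evalD s t l :
  affine_eval (s + t) l = affine_eval s l + affine_eval t l.
Proof.
rewrite /affine_eval addrACA -big_split; congr (_ + _).
by apply: eq_bigr => j _; rewrite ffunE mulrDl.
Qed.

Definition affine_scale (a : R) s : affine :=
  ([ffun j => a * s.1 j], a * s.2).

Lemma affine_evalZ a s l : affine_eval (affine_scale a s) l = a * affine_eval s l.
Proof.
rewrite /affine_eval mulrDr mulr_sumr; congr (_ + _).
by apply: eq_bigr => j _; rewrite ffunE mulrA.
Qed.

Lemma affine_eval_update s l j (z : R) :
  affine_eval s (fun i => if i == j then z else l i) =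
  affine_eval s l + s.1 j * (z - l j).
Proof.
rewrite /affine_eval (bigD1 j) //= [in RHS](bigD1 j) //= eqxx.
rewrite (eq_bigr (fun i => s.1 i * l i)); first by ring.
by move=> i /negPf ->.
Qed.

(** [C] is a convex cone given as a predicate: since elimination only forms positive combinations of
    members of [S], an instance can make [C] record where a constant certificate comes from. *)
Variable C : affine -> Prop.
Hypothesis C_add : forall s t, C s -> C t -> C (s + t).
Hypothesis C_scale : forall (a : R) s, 0 < a -> C s -> C (affine_scale a s).

(* Fourier-Motzkin elimination of the coordinates one at a time. *)
Lemma gordan_alternative_supp (r : seq J) (S : seq affine) :
  (forall s, s \in S -> C s) ->
  (forall s j, s \in S -> j \notin r -> s.1 j = 0) ->
  (exists l, forall s, s \in S -> 0 < affine_eval s l) \/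
  (exists2 d : R, d <= 0 & C (0, d)).
Proof.
elim: r S => [|j r IH] S CS supp.
  (* With no coordinate left all members of [S] are constants: a nonpositive one is the certificate,
     and otherwise any [l] works. *)
  have [/hasP[s sS s_le0] | /hasPn S_gt0] := boolP (has (fun s : affine => s.2 <= 0) S).
    right; exists s.2 => //; suff <- : s.1 = 0 by rewrite -surjective_pairing; exact: CS.
    by apply/ffunP => j; rewrite supp // ffunE.
  left; exists (fun=> 0) => s sS; rewrite /affine_eval big1 ?add0r; last first.
    by move=> i _; rewrite mulr0.
  by rewrite ltNge; exact: S_gt0.
(* Members of [Sp] bound coordinate [j] from below, those of [Sn] from above; [mix] rescales one of
   each by positive factors so that [j] cancels. *)
pose Sp := [seq s : affine <- S | 0 < s.1 j]; pose Sn := [seq s : affine <- S | s.1 j < 0].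
pose mix s t : affine := affine_scale (s.1 j)^-1 s + affine_scale (- t.1 j)^-1 t.
have mixj s t : s \in Sp -> t \in Sn -> (mix s t).1 j = 0.
  rewrite !mem_filter => /andP[s0 _] /andP[t0 _]; rewrite /= !ffunE.
  by rewrite mulVf ?gt_eqF // invrN mulNr mulVf ?lt_eqF // subrr.
have [||[l S0]|] :=
    IH ([seq s : affine <- S | s.1 j == 0] ++ [seq mix s t | s <- Sp, t <- Sn]).
- move=> s; rewrite mem_cat => /orP[|/allpairsP[[t u] /= [tp un ->]]].
    by rewrite mem_filter => /andP[_]; exact: CS.
  move: tp un; rewrite !mem_filter => /andP[t0 tS] /andP[u0 uS].
  by apply: C_add; apply: C_scale; rewrite ?invr_gt0 ?oppr_gt0 //; exact: CS.
- move=> s i + ir; rewrite mem_cat => /orP[|/allpairsP[[t u] /= [tp un ->]]].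
    rewrite mem_filter => /andP[/eqP s0 sS].
    by have [-> //|ij] := eqVneq i j; rewrite supp // inE negb_or ij.
  have [->|ij] := eqVneq i j; first exact: mixj.
  move: tp un; rewrite !mem_filter => /andP[t0 tS] /andP[u0 uS].
  by rewrite /= !ffunE (supp t i) ?(supp u i) ?inE ?negb_or ?ij // !mulr0 addr0.
(* [root s] is the value of coordinate [j] at which [s] vanishes, the others being kept from [l].
   Positivity of [mix s t] at [l] says [root s < root t], so some [z] fits strictly between all
   lower and all upper bounds. *)
- pose root s : R := l j - affine_eval s l / s.1 j.
  have [a b /mapP[s sp ->] /mapP[t tn ->]|z [ltt ttl]] :=
    @strictly_between _ [seq root s | s <- Sp] [seq root s | s <- Sn].
    have := S0 (mix s t); rewrite mem_cat (allpairs_f mix) ?orbT // => /(_ isT).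
    rewrite affine_evalD !affine_evalZ /root invrN mulrC [X in _ + X]mulrC => ?.
    lra.
  left; exists (fun i => if i == j then z else l i) => s sS.
  rewrite affine_eval_update.
  have [s0|s0|s0] := ltrgt0P (s.1 j).
  + have /ltt : root s \in [seq root s | s <- Sp].
      by rewrite map_f // mem_filter s0.
    rewrite /root ltrBlDr -ltrBlDl => h; rewrite -[X in X + _](divfK (lt0r_neq0 s0)).
    nra.
  + have /ttl : root s \in [seq root s | s <- Sn].
      by rewrite map_f // mem_filter s0.
    rewrite /root; set q := _ / _ => h.
    have -> : affine_eval s l = q * s.1 j by rewrite /q divfK // lt_eqF.
    nra.
  + rewrite s0 mul0r addr0; apply: S0.
    by rewrite mem_cat mem_filter s0 eqxx sS.
- by right.
Qed.

Lemma gordan_alternative (S : seq affine) :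
  (forall s, s \in S -> C s) ->
  (exists l, forall s, s \in S -> 0 < affine_eval s l) \/
  (exists2 d : R, d <= 0 & C (0, d)).
Proof.
move=> CS; apply: (@gordan_alternative_supp (enum J)) => // s j _.
by rewrite mem_enum.
Qed.

End Alternative.

(** * Labelings of the rays and the energies of (CTG) *)

Section Duality.
Variables (R : realType) (I : dt_instance R).

Local Notation k := (dt_k I).
Local Notation V := (dt_V I).
Local Notation m := (dt_m I).
Local Notation labeling := {ffun V -> 'I_k}.

Implicit Types (i : 'I_m) (u v : V) (a c : 'I_k) (x : labeling).
Implicit Types (lambda : CTG_multiplier I) (p : 'I_m -> labeling -> R).

Definition label0 : 'I_k := Ordinal (ltnW (dt_k_ge2 I)).

Definition on_ray i u v : bool :=
  infix [:: u; v] (dt_ray i) || infix [:: v; u] (dt_ray i).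

Lemma mem_dt_U i u : (u \in dt_U i) = (u \in dt_ray i).
Proof. by rewrite inE dt_rayE. Qed.

Lemma infix2_mem i u v :
  infix [:: u; v] (dt_ray i) -> (u \in dt_U i) && (v \in dt_U i).
Proof.
by move=> /mem_infix uv; rewrite !mem_dt_U !uv // !inE eqxx ?orbT.
Qed.

Lemma on_ray_mem i u v : on_ray i u v -> (u \in dt_U i) && (v \in dt_U i).
Proof. by case/orP => /infix2_mem // /andP[-> ->]. Qed.

Lemma infix2_index i u v :
  infix [:: u; v] (dt_ray i) -> index v (dt_ray i) = (index u (dt_ray i)).+1.
Proof.
have := dt_ray_uniq i => + /infixP[s [t E]]; rewrite {}E => Us.
move: Us; rewrite cat_uniq => /and3P[_ /hasPn ns /andP[+ _]].
rewrite inE negb_or => /andP[uv _].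
have /negPf us : u \notin s by apply: ns; rewrite !inE eqxx.
have /negPf vs : v \notin s by apply: ns; rewrite !inE eqxx orbT.
by rewrite !index_cat us vs !inE !eqxx orbT /= eqxx (negPf uv) eqxx addn0 addn1.
Qed.

(** The nodes of a ray are distinct, so [u] and [v] cannot each be the immediate successor of the
    other: at most one summand is 1. *)
Lemma on_rayE i u v :
  (on_ray i u v : nat) =
  (infix [:: u; v] (dt_ray i) + infix [:: v; u] (dt_ray i))%N.
Proof.
rewrite /on_ray; case: (boolP (infix [:: u; v] _)) => [/infix2_index uv|//].
case: (boolP (infix [:: v; u] _)) => [/infix2_index|//].
by rewrite uv => /eqP; rewrite -addn2 -[X in X == _]addn0 eqn_add2l.
Qed.

(** Rays are handled through labelings of all of [V], avoiding functions on a subtype that depends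
    on [i]; labels off the ray affect neither [ray_ok] nor the energies. *)
Definition ray_ok i x : bool := (\sum_(u in dt_U i) x u == dt_b i)%N.

Definition pair_cost i x : R :=
  \sum_(e in dt_edges I | on_ray i e.1 e.2) dt_pair e.1 e.2 (x e.1) (x e.2).

Definition ray_energy lambda i x : R :=
  \sum_(u in dt_U i) lambda i u (x u) + pair_cost i x.

Definition restrict i x : {ffun {u : V | u \in dt_U i} -> 'I_k} :=
  [ffun u => x (val u)].

Lemma restrict_surj i y : exists x, y = restrict i x.
Proof.
exists [ffun u => if insub u is Some u' then y u' else label0].
by apply/ffunP => u; rewrite !ffunE valK.
Qed.

Lemma pair_costE i x :
  pair_cost i x =
  \sum_(u in dt_U i) \sum_(v in dt_U i | infix [:: u; v] (dt_ray i) && dt_adj u v)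
     dt_theta u v (x u) (x v).
Proof.
pose F u v := dt_pair u v (x u) (x v).
(* The first sum collects the edges stored in the direction of the ray, the second those stored
   against it. *)
have split_cost : pair_cost i x =
    \sum_u \sum_v (((u, v) \in dt_edges I) && infix [:: u; v] (dt_ray i))%:R * F u v
  + \sum_u \sum_v (((v, u) \in dt_edges I) && infix [:: u; v] (dt_ray i))%:R * F v u.
  rewrite [X in _ = _ + X]exchange_big -big_split /=.
  under [RHS]eq_bigr => u _ do rewrite -big_split /=.
  rewrite pair_bigA /= [LHS]big_mkcond /=; apply: eq_bigr => -[u v] _ /=.
  rewrite -mulrDl -natrD; case: ((u, v) \in _); rewrite /= ?mul0r //.
  by rewrite -on_rayE; case: on_ray; rewrite ?mul1r ?mul0r.
rewrite split_cost -big_split [RHS]big_mkcond; apply: eq_bigr => u _.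
rewrite -big_split; case: ifPn => uU; last first.
  rewrite big1 // => v _; rewrite [infix _ _](contraNF _ uU); last first.
    by move=> /infix2_mem/andP[].
  by rewrite !andbF !mul0r /= addr0.
rewrite [RHS]big_mkcond; apply: eq_bigr => v _ /=.
have [uv|_] := boolP (infix [:: u; v] _); last by rewrite /= !andbF !mul0r addr0.
have /andP[_ ->] := infix2_mem uv; rewrite !andbT /dt_adj /dt_theta.
have := @dt_edges_once _ I u v; case: ((u, v) \in _) => /= [/(_ isT)/negPf ->|_].
  by rewrite mul1r mul0r addr0.
by case: ((v, u) \in _); rewrite ?mul1r ?mul0r ?add0r.
Qed.

Lemma CTG_energyE lambda i x :
  CTG_energy lambda (restrict i x) =
  if ray_ok i x then (ray_energy lambda i x)%:E else +oo%E.
Proof.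
rewrite /CTG_energy /ray_ok /ray_energy pair_costE !(big_sub (mem (dt_U i))) /=.
have -> : (\sum_u restrict i x u = \sum_(u : {u | u \in dt_U i}) x (val u))%N.
  by apply: eq_bigr => u _; rewrite ffunE.
case: ifP => // _; congr (_ + _)%:E; first by apply: eq_bigr => u _; rewrite ffunE.
apply: eq_bigr => u _; rewrite [RHS](big_sub_cond (mem (dt_U i))).
by apply: eq_bigr => v _; rewrite !ffunE.
Qed.

(** The labeling [x0] makes the minimum finite, so a minimizer cannot violate the sum constraint. *)
Lemma ray_min_attained lambda i x0 : ray_ok i x0 ->
  exists2 x, ray_ok i x &
    \big[Order.min/+oo%E]_(y : {ffun {u : V | u \in dt_U i} -> 'I_k})
       CTG_energy lambda y = (ray_energy lambda i x)%:E.
Proof.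
move=> ok0.
rewrite (@bigmin_eq_arg _ _ _ _ (restrict i x0)) //; last by move=> *; exact: leey.
case: arg_minP => // y _ ymin.
have [x yx] := restrict_surj y; exists x.
  move: (ymin (restrict i x0) isT); rewrite yx !CTG_energyE ok0.
  by case: ifP => // _; rewrite leye_eq.
move: (ymin (restrict i x0) isT); rewrite yx !CTG_energyE ok0.
by case: ifP => // _; rewrite leye_eq.
Qed.

Lemma ray_min_infeasible lambda i : (forall x, ~~ ray_ok i x) ->
  \big[Order.min/+oo%E]_(y : {ffun {u : V | u \in dt_U i} -> 'I_k})
       CTG_energy lambda y = +oo%E.
Proof.
move=> nok; apply: big1_idem; [exact: minxx | move=> y _].
by have [x ->] := restrict_surj y; rewrite CTG_energyE (negPf (nok x)).
Qed.

Lemma CTG_objective_infeasible lambda i : (forall x, ~~ ray_ok i x) ->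
  CTG_objective lambda = +oo%E.
Proof.
(* An extended sum is [+oo] once a term is, provided that no term is [-oo]; each ray minimum is
   either attained at a real value or [+oo]. *)
move=> nok; apply/esum_eqyP => [j _|]; last first.
  by exists i; split; rewrite ?mem_index_enum // ray_min_infeasible.
have [/existsP[x okx]|] := boolP [exists x, ray_ok j x].
  by have [y _ ->] := ray_min_attained lambda okx.
by rewrite negb_exists => /forallP nokj; rewrite ray_min_infeasible.
Qed.

Lemma CTG_objective_attained lambda : (forall i, exists x, ray_ok i x) ->
  exists2 X : 'I_m -> labeling, forall i, ray_ok i (X i) &
    CTG_objective lambda = (\sum_i ray_energy lambda i (X i))%:E.
Proof.
move=> ok.
have att i : exists x, ray_ok i x &&
    (\big[Order.min/+oo%E]_(y : {ffun {u : V | u \in dt_U i} -> 'I_k})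
       CTG_energy lambda y == (ray_energy lambda i x)%:E).
  have [x0 /(ray_min_attained lambda)[x okx ->]] := ok i.
  by exists x; rewrite okx eqxx.
exists (fun i => xchoose (att i)) => [i|]; first by case/andP: (xchooseP (att i)).
rewrite -sumEFin; apply: eq_bigr => i _.
by case/andP: (xchooseP (att i)) => _ /eqP.
Qed.

(** * Weights on labelings, their gap and cost, and centered multipliers *)

Definition ray_count u : R := (#|[set i | u \in dt_U i]|)%:R.

Definition marg p i u a : R := \sum_(x : labeling | x u == a) p i x.

Definition avg_marg p u a : R :=
  (\sum_(i | u \in dt_U i) marg p i u a) / ray_count u.

(* [gap p = 0] says that the node marginals of p agree across rays; it is the
   linear part, in l, of the total energy for the multipliers [center l]. *)
Definition gap p : {ffun 'I_m * V * 'I_k -> R} :=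
  [ffun j => if j.1.2 \in dt_U j.1.1 then
               marg p j.1.1 j.1.2 j.2 - avg_marg p j.1.2 j.2 else 0].

Definition cost p : R := \sum_i \sum_(x : labeling) p i x * pair_cost i x.

(* Subtracting the average over the rays through u projects arbitrary
   multipliers onto the feasible ones. *)
Definition center (l : 'I_m * V * 'I_k -> R) : CTG_multiplier I := fun i u a =>
  l (i, u, a) - (\sum_(i' | u \in dt_U i') l (i', u, a)) / ray_count u.

(** The mass [z], common to all rays, is left free so that weights of positive mass form a cone;
    mass 1 gives one probability distribution per ray. *)
Record weights (z : R) p : Prop := Weights {
  weights_ge0 : forall i x, 0 <= p i x;
  weights_ok : forall i x, ~~ ray_ok i x -> p i x = 0;
  weights_sum : forall i, \sum_(x : labeling) p i x = z
}.

Lemma ray_count_gt0 i u : u \in dt_U i -> 0 < ray_count u.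
Proof. by move=> ui; rewrite ltr0n; apply/card_gt0P; exists i; rewrite inE. Qed.

Lemma center_feasible l : CTG_feasible (center l).
Proof.
move=> u a; rewrite big_split /= sumrN sumr_const.
have [i ui|none] := pickP (fun i => u \in dt_U i); last first.
  by rewrite big_pred0 // (eq_card0 none) mulr0n subr0.
have -> : #|[pred i | u \in dt_U i]| = #|[set i | u \in dt_U i]| by rewrite cardsE.
rewrite -mulr_natr divfK ?subrr // lt0r_neq0 //; exact: ray_count_gt0 ui.
Qed.

(** Subtracting the average over the rays through a node is a self-adjoint operation, so it may be
    moved from the marginals of [p] to the multipliers [l]. *)
Lemma sum_gap p l :
  \sum_j gap p j * l j =
  \sum_i \sum_(u in dt_U i) \sum_a center l i u a * marg p i u a.
Proof.
have -> : \sum_j gap p j * l j = \sum_i \sum_u \sum_a gap p (i, u, a) * l (i, u, a).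
  rewrite pair_bigA (pair_bigA _ (fun iu a => gap p (iu.1, iu.2, a) * l (iu.1, iu.2, a))).
  by apply: eq_bigr => -[[i u] a].
rewrite exchange_big [RHS](exchange_big_dep predT) //=; apply: eq_bigr => u _.
rewrite exchange_big [RHS]exchange_big /=; apply: eq_bigr => a _.
rewrite (bigID (fun i => u \in dt_U i)) /=.
rewrite [X in _ + X]big1 ?addr0; last first.
  by move=> i /negPf ui; rewrite ffunE /= ui mul0r.
under eq_bigr => i ui do rewrite ffunE /= ui mulrBl.
under [RHS]eq_bigr => i ui do rewrite mulrBl.
rewrite !big_split /= !sumrN; congr (_ - _).
  by apply: eq_bigr => i _; rewrite mulrC.
by rewrite -mulr_sumr -mulr_sumr /avg_marg; ring.
Qed.

Lemma margD p q i u a :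
  marg (fun i x => p i x + q i x) i u a = marg p i u a + marg q i u a.
Proof. exact: big_split. Qed.

Lemma margZ (z : R) p i u a : marg (fun i x => z * p i x) i u a = z * marg p i u a.
Proof. by rewrite /marg mulr_sumr. Qed.

Lemma gapD p q : gap (fun i x => p i x + q i x) = gap p + gap q.
Proof.
apply/ffunP => j; rewrite !ffunE; case: ifP => _; last by rewrite addr0.
rewrite margD /avg_marg; under eq_bigr do rewrite margD.
by rewrite big_split /=; ring.
Qed.

Lemma gapZ (z : R) p : gap (fun i x => z * p i x) = [ffun j => z * gap p j].
Proof.
apply/ffunP => j; rewrite !ffunE; case: ifP => _; last by rewrite mulr0.
rewrite margZ /avg_marg; under eq_bigr do rewrite margZ.
by rewrite -mulr_sumr; ring.
Qed.

Lemma costD p q : cost (fun i x => p i x + q i x) = cost p + cost q.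
Proof.
rewrite /cost -big_split; apply: eq_bigr => i _; rewrite -big_split.
by apply: eq_bigr => x _; rewrite mulrDl.
Qed.

Lemma costZ (z : R) p : cost (fun i x => z * p i x) = z * cost p.
Proof.
rewrite /cost mulr_sumr; apply: eq_bigr => i _; rewrite mulr_sumr.
by apply: eq_bigr => x _; rewrite mulrA.
Qed.

Lemma weightsD (y z : R) p q : weights y p -> weights z q ->
  weights (y + z) (fun i x => p i x + q i x).
Proof.
move=> [p0 pok py] [q0 qok qz]; split=> [i x|i x nok|i].
- by rewrite addr_ge0.
- by rewrite pok ?qok ?addr0.
- by rewrite big_split /= py qz.
Qed.

Lemma weightsZ (y z : R) p : 0 <= y -> weights z p ->
  weights (y * z) (fun i x => y * p i x).
Proof.
move=> y0 [p0 pok pz]; split=> [i x|i x nok|i].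
- by rewrite mulr_ge0.
- by rewrite pok ?mulr0.
- by rewrite -mulr_sumr pz.
Qed.

Definition point_mass (X : 'I_m -> labeling) : 'I_m -> labeling -> R :=
  fun i x => (x == X i)%:R.

Lemma sum_point_mass (X : 'I_m -> labeling) i (F : labeling -> R) :
  \sum_(x : labeling) point_mass X i x * F x = F (X i).
Proof.
rewrite (bigD1 (X i)) //= /point_mass eqxx mul1r big1 ?addr0 // => x /negPf ->.
by rewrite mul0r.
Qed.

Lemma weights_point_mass (X : 'I_m -> labeling) :
  (forall i, ray_ok i (X i)) -> weights 1 (point_mass X).
Proof.
move=> ok; split=> [i x|i x|i]; rewrite ?ler0n //.
  by rewrite /point_mass; case: eqP => // ->; rewrite ok.
by rewrite -[RHS](sum_point_mass X i (fun=> 1)); apply: eq_bigr => x _; rewrite mulr1.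
Qed.

(** This exhibits the total energy of a choice [X] as an affine function of [l], the form that
    [gordan_alternative] takes. *)
Lemma sum_gap_point_mass (X : 'I_m -> labeling) l :
  \sum_j gap (point_mass X) j * l j + cost (point_mass X) =
  \sum_i ray_energy (center l) i (X i).
Proof.
rewrite sum_gap /cost -big_split; apply: eq_bigr => i _ /=.
rewrite sum_point_mass; congr (_ + _); apply: eq_bigr => u _.
rewrite (bigD1 (X i u)) //= big1 ?addr0 => [|a /negPf aX].
  rewrite /marg (bigD1 (X i)) //= big1 ?addr0 /point_mass ?eqxx ?mulr1 //.
  by move=> x /andP[_ /negPf ->].
rewrite /marg big1 ?mulr0 // => x /eqP xa; rewrite /point_mass.
by case: eqP => // xX; rewrite -xa xX eqxx in aX.
Qed.

(** The alternative is applied to the total energy minus [c], over all choices of admissible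
    labelings. An [l] making all of these positive would push the objective at [center l] above [c];
    the other outcome is a weight system with zero gap, up to scaling. *)
Lemma consistent_weights (c : R) :
  (forall lambda, CTG_feasible lambda -> (CTG_objective lambda <= c%:E)%E) ->
  exists p, [/\ weights 1 p, gap p = 0 & cost p <= c].
Proof.
move=> ub.
(* A ray without admissible labeling would make the objective [+oo] already at zero multipliers. *)
have ok i : exists x, ray_ok i x.
  apply/existsP; rewrite -[X in is_true X]negbK; apply/negP => /existsPn nok.
  have feas0 : CTG_feasible ((fun _ _ _ => 0) : CTG_multiplier I).
    by move=> u a; rewrite big1.
  by have := ub _ feas0; rewrite (CTG_objective_infeasible _ nok) leye_eq.
pose C (s : {ffun 'I_m * V * 'I_k -> R} * R) :=
  exists z p, [/\ 0 < z, weights z p & s = (gap p, cost p - z * c)].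
pose vec (X : {ffun 'I_m -> labeling}) :=
  (gap (point_mass X), cost (point_mass X) - c).
pose S := [seq vec X | X in
  [pred X : {ffun 'I_m -> labeling} | [forall i, ray_ok i (X i)]]].
have [||s sS|[l l_gt0]|[d d_le0 [z [p [z0 pz [gp dE]]]]]] :=
    @gordan_alternative _ _ C _ _ S.
- move=> _ _ [y [p [y0 py ->]]] [z [q [z0 qz ->]]].
  exists (y + z), (fun i x => p i x + q i x); split; [exact: addr_gt0|exact: weightsD|].
  by rewrite gapD costD; congr (_, _); rewrite /=; ring.
- move=> a _ a0 [z [p [z0 pz ->]]]; exists (a * z), (fun i x => a * p i x).
  split; [exact: mulr_gt0 | exact: (weightsZ (ltW a0)) |].
  by rewrite gapZ costZ /affine_scale; congr (_, _); rewrite /=; ring.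
- move: sS => /mapP[X]; rewrite mem_enum inE => /forallP okX ->.
  exists 1, (point_mass X); split=> //; first exact: weights_point_mass.
  by rewrite mul1r.
(* The labelings attaining the ray minima at [center l] have total energy at most [c], yet they
   define a member of [S]. *)
- have [X okX objE] := CTG_objective_attained (center l) ok.
  have := ub _ (center_feasible l); rewrite objE lee_fin -sum_gap_point_mass.
  have : vec (finfun X) \in S.
    by apply: map_f; rewrite mem_enum inE; apply/forallP => i; rewrite ffunE.
  move=> /l_gt0; rewrite /affine_eval /= (_ : point_mass (finfun X) = point_mass X).
    by rewrite addrA subr_gt0 ltNge => /negP.
  by apply/boolp.funext => i; rewrite /point_mass ffunE.
(* Normalize the mass to 1; [d <= 0] reads [cost p <= z * c]. *)
- exists (fun i x => z^-1 * p i x); split.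
  + by rewrite -(mulVf (lt0r_neq0 z0)); apply: weightsZ; rewrite // invr_ge0 ltW.
  + by rewrite gapZ -gp; apply/ffunP => j; rewrite !ffunE mulr0.
  + by rewrite costZ mulrC ler_pdivrMr // mulrC -subr_le0 -dE.
Qed.

(** * From weights to a feasible point of (STD) *)

(* Nodes on no ray carry no edge, so any distribution will do there. *)
Definition node_marg p u a : R :=
  if [exists i, u \in dt_U i] then avg_marg p u a else (a == label0)%:R.

(* The outer sum has exactly one term when (u, v) is an edge. *)
Definition edge_marg p u v a c : R :=
  \sum_(i | on_ray i u v) \sum_(x : labeling | (x u == a) && (x v == c)) p i x.

Lemma node_margE p i u a :
  gap p = 0 -> u \in dt_U i -> node_marg p u a = marg p i u a.
Proof.
move=> /ffunP/(_ (i, u, a)) + ui; rewrite !ffunE /= ui => /eqP.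
rewrite subr_eq0 => /eqP ->; rewrite /node_marg ifT //.
by apply/existsP; exists i.
Qed.

Lemma sum_marg p i u (F : 'I_k -> R) :
  \sum_a F a * marg p i u a = \sum_(x : labeling) F (x u) * p i x.
Proof.
rewrite [RHS](partition_big (fun x : labeling => x u) predT) //=.
by apply: eq_bigr => a _; rewrite mulr_sumr; apply: eq_bigr => x /eqP ->.
Qed.

Lemma edge_on_ray u v : (u, v) \in dt_edges I ->
  exists2 i, on_ray i u v & forall j, on_ray j u v = (j == i).
Proof.
move=> /dt_edge_ray[i [iuv uniq_i]]; exists i => // j.
by apply/idP/eqP => [/uniq_i|->].
Qed.

(** On the only ray containing the edge, [edge_marg] is a joint marginal of [p i]; summing out one
    end leaves a marginal of [p i], which is the node marginal because the gap vanishes. *)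
Lemma edge_marg_l p u v a : gap p = 0 -> (u, v) \in dt_edges I ->
  \sum_c edge_marg p u v a c = node_marg p u a.
Proof.
move=> gp /edge_on_ray[i /on_ray_mem/andP[ui _] iE].
rewrite (node_margE _ gp ui) /marg (partition_big (fun x : labeling => x v) predT) //=.
by apply: eq_bigr => c _; rewrite /edge_marg (big_pred1 i).
Qed.

Lemma edge_marg_r p u v c : gap p = 0 -> (u, v) \in dt_edges I ->
  \sum_a edge_marg p u v a c = node_marg p v c.
Proof.
move=> gp /edge_on_ray[i /on_ray_mem/andP[_ vi] iE].
rewrite (node_margE _ gp vi) /marg (partition_big (fun x : labeling => x u) predT) //=.
apply: eq_bigr => a _; rewrite /edge_marg (big_pred1 i) //.
by apply: eq_bigl => x; rewrite andbC.
Qed.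

Lemma weights_STD_feasible p :
  weights 1 p -> gap p = 0 -> STD_feasible (node_marg p) (edge_marg p).
Proof.
move=> [p0 pok p1] gp; split.
- move=> u a; have [/existsP[i ui]|none] := boolP [exists i, u \in dt_U i].
    by rewrite (node_margE _ gp ui) sumr_ge0.
  by rewrite /node_marg (negPf none) ler0n.
- by move=> u v a c _; apply: sumr_ge0 => i _; apply: sumr_ge0.
- move=> u; have [/existsP[i ui]|none] := boolP [exists i, u \in dt_U i].
    rewrite -(p1 i) -[RHS](eq_bigr _ (fun x _ => mul1r (p i x))).
    rewrite -(sum_marg p i u (fun=> 1)).
    by apply: eq_bigr => a _; rewrite mul1r (node_margE _ gp ui).
  rewrite /node_marg (negPf none) (bigD1 label0) //= big1 ?addr0 //.
  by move=> a /negPf ->.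
- by move=> u v c; apply: edge_marg_r.
- by move=> u v a; apply: edge_marg_l.
- move=> i; transitivity (\sum_(u in dt_U i) \sum_(x : labeling) (x u)%:R * p i x).
    rewrite [RHS]big_mkcond; apply: eq_bigr => u _; rewrite [u \in dt_U i]inE.
    case: ifP => ui; last by rewrite mul0r.
    rewrite mul1r -(sum_marg p i u (fun a : 'I_k => (val a)%:R)).
    by apply: eq_bigr => a _; rewrite (@node_margE _ i) // inE.
  (* Every labeling carrying weight has label sum [dt_b i] on the ray, hence so does the average. *)
  transitivity (\sum_(x : labeling) (dt_b i)%:R * p i x).
    rewrite exchange_big /=; apply: eq_bigr => x _.
    have [/eqP <-|/pok ->] := boolP (ray_ok i x); last first.
      by rewrite mulr0 big1 // => u _; rewrite mulr0.
    by rewrite natr_sum mulr_suml.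
  by rewrite -mulr_sumr p1 mulr1.
Qed.

Lemma STD_objective_weights p :
  STD_objective (node_marg p) (edge_marg p) = cost p.
Proof.
rewrite /STD_objective big1 ?add0r; last first.
  by move=> u _; rewrite big1 // => a _; rewrite dt_unary0 mul0r.
transitivity (\sum_(e in dt_edges I) \sum_(i | on_ray i e.1 e.2)
    \sum_(x : labeling) p i x * dt_pair e.1 e.2 (x e.1) (x e.2)).
  apply: eq_bigr => -[u v] _ /=; rewrite pair_bigA /=.
  under eq_bigr do rewrite mulr_sumr.
  rewrite exchange_big; apply: eq_bigr => i _ /=.
  (* Group the labelings by the pair of labels they give to the two ends of the edge. *)
  rewrite [RHS](partition_big (fun x : labeling => (x u, x v)) predT) //=.
  apply: eq_bigr => -[a c] _ /=; rewrite mulr_sumr.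
  apply: eq_big => x; first by rewrite xpair_eqE.
  by move=> /andP[/eqP -> /eqP ->]; rewrite mulrC.
rewrite (exchange_big_dep predT) //=; apply: eq_bigr => i _.
rewrite exchange_big /=; apply: eq_bigr => x _.
by rewrite /pair_cost mulr_sumr.
Qed.

Lemma val_STD_le_CTG : (val_STD I <= val_CTG I)%E.
Proof.
have le_fin (c : R) : (val_CTG I <= c%:E)%E -> (val_STD I <= c%:E)%E.
  move=> CTGc; have [|p [p1 gp pc]] := @consistent_weights c.
    move=> lambda feas; apply: le_trans CTGc.
    by apply: ereal_sup_ubound; exists lambda.
  apply: (@le_trans _ _ (cost p)%:E); last by rewrite lee_fin.
  apply: ereal_inf_lbound; exists (node_marg p, edge_marg p) => /=.
    exact: weights_STD_feasible.
  by rewrite STD_objective_weights.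
move: le_fin; case: (val_CTG I) => [c||] le_fin; [exact: le_fin | exact: leey |].
(* If (CTG) has value [-oo], every real bounds (STD) from above, which rules out a real value and
   [+oo]. *)
move: le_fin; case: (val_STD I) => [c||] le_fin //.
  have := le_fin (c - 1) (leNye _).
  by rewrite lee_fin lerBrDr gerDl ler10.
by have := le_fin 0 (leNye _).
Qed.

End Duality.

(** * An instance where the inequality is strict *)

Section Gap.
Variable R : realType.

Let gap_edges : {set bool * bool} := [set (false, true)].
Let gap_unary (u : bool) (a : 'I_2) : R := 0.
Let gap_pair (u v : bool) (a c : 'I_2) : R := (a != c)%:R.
Let gap_A (i : 'I_1) (u : bool) := true.
Let gap_ray (i : 'I_1) := [:: false; true].

Fact gap_edges_once u v : (u, v) \in gap_edges -> (v, u) \notin gap_edges.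
Proof. by rewrite !inE => /eqP[-> ->]. Qed.

Fact gap_rayE i u : (u \in gap_ray i) = gap_A i u.
Proof. by case: u. Qed.

Fact gap_ray_nonempty i : exists u, gap_A i u.
Proof. by exists true. Qed.

Fact gap_edge_ray u v : (u, v) \in gap_edges ->
  exists! i, infix [:: u; v] (gap_ray i) || infix [:: v; u] (gap_ray i).
Proof.
by rewrite inE => /eqP[-> ->]; exists ord0; split=> // i _; rewrite [i]ord1.
Qed.

Definition gap_instance : dt_instance R :=
  @DTInstance R 2 bool gap_edges gap_unary gap_pair 1 gap_A (fun=> 1%N) gap_ray
    isT gap_edges_once (fun _ _ => erefl) (fun=> isT) gap_rayE gap_ray_nonempty
    gap_edge_ray.

Lemma gap_CTG_ge1 : (1%:E <= val_CTG gap_instance)%E.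
Proof.
pose lambda0 : CTG_multiplier gap_instance := fun _ _ _ => 0.
apply: (@le_trans _ _ (CTG_objective lambda0)); last first.
  by apply: ereal_sup_ubound; exists lambda0 => // u a; rewrite big1.
rewrite /CTG_objective big_ord1; apply: le_bigmin => [|y _]; first exact: leey.
have [x ->] := restrict_surj y; rewrite CTG_energyE; case: ifP => [|_]; last exact: leey.
rewrite /ray_ok /ray_energy [X in X + _]big1 // add0r lee_fin /pair_cost.
rewrite (big_pred1 (false, true)) => [|[u v]]; last first.
  by rewrite /= inE; case: eqP => // -[-> ->].
rewrite (eq_bigl predT) => [|u]; last by rewrite inE; case: u.
rewrite big_bool /= /gap_pair => xb.
(* Equal labels would have an even sum, whereas [b] is 1. *)
suff -> : x false != x true by [].
apply/eqP => xE; move: xb; rewrite xE addnn => /eqP/(congr1 odd).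
by rewrite odd_double.
Qed.

Lemma gap_STD_le0 : (val_STD gap_instance <= 0)%E.
Proof.
(* Uniform node marginals give each node mean label 1/2, so the ray constraint holds on average,
   while the diagonal [mu2] avoids all cost. *)
pose mu1 (u : bool) (a : 'I_2) : R := 2^-1.
pose mu2 (u v : bool) (a c : 'I_2) : R := (a == c)%:R / 2.
apply: ereal_inf_lbound; exists (mu1, mu2) => /=.
  split=> [u a|u v a c _|u|u v c _|u v a _|i].
  - by rewrite invr_ge0 ler0n.
  - by rewrite divr_ge0 ?ler0n.
  - by rewrite !big_ord_recl big_ord0 /mu1; lra.
  - by rewrite (bigD1 c) //= /mu2 eqxx mul1r big1 ?addr0 // => a /negPf ->; rewrite mul0r.
  - rewrite (bigD1 a) //= /mu2 eqxx mul1r big1 ?addr0 // => c /negPf.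
    by rewrite eq_sym => ->; rewrite mul0r.
  - by rewrite big_bool /= !big_ord_recl big_ord0 /mu1 /= (_ : bump 0 0 = 1%N) //; lra.
congr (_%:E); rewrite /STD_objective big1 ?add0r => [|u _]; last first.
  by rewrite big1 // => a _; rewrite mul0r.
rewrite big1 // => e _; rewrite big1 // => a _; rewrite big1 // => c _.
by rewrite /= /gap_pair /mu2; case: eqP; rewrite ?mul0r ?mulr0.
Qed.

End Gap.

Theorem proposition1 (R : realType) :
  (forall I : dt_instance R, (val_STD I <= val_CTG I)%E) /\
  (exists I : dt_instance R, (val_STD I < val_CTG I)%E).
Proof.
split=> [I|]; first exact: val_STD_le_CTG.
exists (gap_instance R); apply: le_lt_trans (gap_STD_le0 R) _.
by apply: lt_le_trans (gap_CTG_ge1 R); rewrite lte_fin ltr01.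
Qed.
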